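(* Let $\ell,m\ge 1$ be integers and $n=\ell+m$. If $L\subset\mathbb R^\ell$ and $M\subset\mathbb R^m$ are convex bodies that are generating sets and $K=L\times M\subset\mathbb R^n$, then the Carathéodory number for $K$-strong convexity is precisely $n$.
   Context: A convex body in $\mathbb R^n$ is a compact convex set with non-empty interior; a convex compactum is a non-empty compact convex set. For sets $K,T\subset\mathbb R^n$ write $$K \ominus T := \bigcap_{t\in T}(K-t),$$ and let $A+B$ denote the Minkowski sum. A convex body $K\subset\mathbb R^n$ is a generating set if every non-empty intersection of its translates is a Minkowski summand of $K$: for every non-empty $T\subset\mathbb R^n$ with $K\ominus T\neq\emptyset$ there is a convex compactum $T'$ with $(K\ominus T)+T'=K$. A set is $K$-strongly convex if it is an intersection of translates of $K$, i.e. of the form $K\ominus T$. For a set $X$ contained in some translate of $K$, its $K$-strongly convex hull is the minimal $K$-strongly convex set containing $X$; it is given by $\operatorname{conv}_K X = K\ominus(K\ominus X)$, i.e. it is the intersection of all translates of $K$ containing $X$ (with $\operatorname{conv}_K\emptyset=\emptyset$). The Carathéodory number for $K$-strong convexity is the minimal integer $c$ such that $$\operatorname{conv}_K (X) = \bigcup_{Y\subseteq X,\ |Y|\le c} \operatorname{conv}_K (Y)$$ for every finite point set $X\subset\mathbb R^n$ contained in a translate of $K$ (it is infinite if no such $c$ exists). *)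

(* Defs.v *)
From mathcomp Require Import all_boot all_order all_algebra.
From mathcomp Require Import all_classical all_reals all_analysis.

Set Implicit Arguments.
Unset Strict Implicit.
Unset Printing Implicit Defensive.

Import Order.TTheory GRing.Theory Num.Theory.
Import numFieldNormedType.Exports.

Local Open Scope classical_set_scope.
Local Open Scope ring_scope.
Local Open Scope card_scope.

Definition translate (V : zmodType) (K : set V) (v : V) : set V :=
  [set x + v | x in K].

Definition minkowski_sum (V : zmodType) (A B : set V) : set V :=
  [set x + y | x in A & y in B].

(* K \ominus T; it is the whole space when T is empty. *)
Definition minkowski_diff (V : zmodType) (K T : set V) : set V :=
  \bigcap_(t in T) translate K (- t).

Definition strongly_convex (V : zmodType) (K A : set V) : Prop :=
  exists T : set V, A = minkowski_diff K T.

(* See [sconv_hull_min] for minimality and [sconv_hull0] for the empty set. *)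
Definition sconv_hull (V : zmodType) (K X : set V) : set V :=
  minkowski_diff K (minkowski_diff K X).

Definition convex_body (R : realType) (n : nat) (K : set 'rV[R]_n) : Prop :=
  [/\ compact K, convex_set K & interior K !=set0].

Definition convex_compactum (R : realType) (n : nat) (K : set 'rV[R]_n) : Prop :=
  [/\ compact K, convex_set K & K !=set0].

Definition generating_set (R : realType) (n : nat) (K : set 'rV[R]_n) : Prop :=
  convex_body K /\
  forall T : set 'rV[R]_n, T !=set0 -> minkowski_diff K T !=set0 ->
    exists2 T' : set 'rV[R]_n,
      convex_compactum T' & minkowski_sum (minkowski_diff K T) T' = K.

(* `I_c is {0, ..., c - 1}, so that Y #<= `I_c means |Y| <= c. *)
Definition caratheodory_property (V : zmodType) (K : set V) (c : nat) : Prop :=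
  forall X : set V, finite_set X -> (exists v, X `<=` translate K v) ->
    sconv_hull K X =
    \bigcup_(Y in [set Y : set V | Y `<=` X /\ Y #<= `I_c]) sconv_hull K Y.

(* No c satisfies this predicate when the Caratheodory number is infinite. *)
Definition is_caratheodory_number (V : zmodType) (K : set V) (c : nat) : Prop :=
  caratheodory_property K c /\
  forall c' : nat, caratheodory_property K c' -> (c <= c')%N.

(* The Cartesian product L x M under the identification of R^l x R^m with
   R^(l + m). *)
Definition set_row_mx (R : realType) (l m : nat)
    (L : set 'rV[R]_l) (M : set 'rV[R]_m) : set 'rV[R]_(l + m) :=
  [set row_mx x y | x in L & y in M].

Lemma minkowski_diffP (V : zmodType) (K T : set V) (x : V) :
  minkowski_diff K T x <-> forall t, T t -> K (x + t).
Proof.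
split=> [KTx t Tt|KTx t Tt]; last by exists (x + t); [exact: KTx|rewrite addrK].
by have [y Ky <-] := KTx t Tt; rewrite subrK.
Qed.

Lemma sconv_hullE (V : zmodType) (K X : set V) :
  sconv_hull K X =
  \bigcap_(v in [set v | X `<=` translate K v]) translate K v.
Proof.
apply/seteqP; split=> y.
- move=> /minkowski_diffP hy v /= Xv; exists (y - v); last by rewrite subrK.
  apply: hy; apply/minkowski_diffP => x Xx.
  by have [z Kz <-] := Xv _ Xx; rewrite addrC addrK.
- move=> hy; apply/minkowski_diffP => s /minkowski_diffP Xs.
  have [x Xx|z Kz <-] := hy (- s); last by rewrite subrK.
  by exists (x + s); [rewrite addrC; exact: Xs|rewrite addrK].
Qed.

Lemma sconv_hull_min (V : zmodType) (K X : set V) :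
  [/\ strongly_convex K (sconv_hull K X), X `<=` sconv_hull K X &
      forall A, strongly_convex K A -> X `<=` A -> sconv_hull K X `<=` A].
Proof.
split.
- by exists (minkowski_diff K X).
- by move=> x Xx; apply/minkowski_diffP => s /minkowski_diffP /(_ _ Xx); rewrite addrC.
- move=> _ [T ->] XT y /minkowski_diffP hy; apply/minkowski_diffP => t Tt.
  apply: hy; apply/minkowski_diffP => x /XT /minkowski_diffP /(_ _ Tt).
  by rewrite addrC.
Qed.

Lemma sconv_hull0 (R : realType) (n : nat) (K : set 'rV[R]_n) :
  (0 < n)%N -> convex_body K -> sconv_hull K set0 = set0.
Proof.
move=> n0 [cK _ _]; rewrite -subset0 => y /minkowski_diffP hy.
have KT x : K x.
  by rewrite -[x](subrKC y); apply: hy; apply/minkowski_diffP.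
have /compact_bounded[M [_ /(_ (M + 1))]] := cK.
rewrite ltrDl ltr01 => /(_ isT) hM.
have := hM (const_mx (`|M| + 2)) (KT _) => /=.
apply/negP; rewrite -ltNge.
apply: (@lt_le_trans _ _ `|(const_mx (`|M| + 2) : 'rV[R]_n) 0 (Ordinal n0)|).
  rewrite mxE ger0_norm ?addr_ge0//.
  by rewrite ler_ltD ?ler_norm// ltr1n.
rewrite [leRHS]mx_normrE.
exact: (le_bigmax _ (fun ij => `|(const_mx (`|M| + 2) : 'rV[R]_n) ij.1 ij.2|) (0, Ordinal n0)).
Qed.

(* Main.v *)
Require Import Defs.
From mathcomp Require Import all_boot all_order all_algebra.
From mathcomp Require Import all_classical all_reals all_analysis.
From mathcomp Require Import ring lra zify.

Set Implicit Arguments.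
Unset Strict Implicit.
Unset Printing Implicit Defensive.

Import Order.TTheory GRing.Theory Num.Theory.
Import numFieldNormedType.Exports.

Local Open Scope classical_set_scope.
Local Open Scope ring_scope.

(* Write [K (-) T] for the Minkowski difference, so that conv_K Y = K (-) (K (-) Y).

   Upper bound.  A generating set K in R^d satisfies a pointed Caratheodory theorem: if
   y is in conv_K X and p is in X, then y is in conv_K Y for some Y containing p with at
   most d + 1 points.  More generally, let the intersections D_Y of a finite family of
   convex compacta inside P be summands of K; then K (-) D_X is the union of the
   K (-) D_Y with |Y| <= dim P.  Shooting a ray from a point of K (-) P reduces this to a
   point of K (-) D_X exposed by a functional u.  Let Z be minimal such that D_Z does not
   exceed the maximum of u on D_X.  A Radon argument shows that the u-face of D_Z has
   dimension at most dim P - |Z|, and induction applies to the u-face of K, the faces of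
   the D_(Z u Y) being its summands; Radstrom cancellation goes back from faces to bodies.

   Hulls in L x M are products of hulls.  Choose A for L and B for M, both containing p,
   with l + 1 and m + 1 points.  If some point of A other than p can enter B without
   expelling p, or conversely, then A and B can be made to share two points; otherwise p
   can be dropped from both.

   Lower bound.  Any convex body K in R^n has n linearly independent normals u_i at
   boundary points touched by balls inside K.  Take x_j with <u_i, x_j> = n [i = j] - 1;
   their sum is 0, so 0 is in conv_K {e x_1, ..., e x_n}.  If x_j is omitted and e is
   small, the translate of K whose j-th touched point lies just short of 0 contains all
   other e x_i but not 0. *)

(** * The Euclidean inner product on row vectors *)

Section dot_product.
Context {R : realType} {n : nat}.
Implicit Types u v w : 'rV[R]_n.

Definition dot u v : R := (u *m v^T) 0 0.

Lemma dotE u v : dot u v = \sum_i u 0 i * v 0 i.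
Proof. by rewrite /dot mxE; apply: eq_bigr => i _; rewrite mxE. Qed.

Lemma dotC u v : dot u v = dot v u.
Proof. by rewrite !dotE; apply: eq_bigr => i _; rewrite mulrC. Qed.

Lemma dotDl u v w : dot (u + v) w = dot u w + dot v w.
Proof. by rewrite /dot mulmxDl mxE. Qed.

Lemma dotDr u v w : dot u (v + w) = dot u v + dot u w.
Proof. by rewrite dotC dotDl !(dotC u). Qed.

Lemma dotZl a u v : dot (a *: u) v = a * dot u v.
Proof. by rewrite /dot -scalemxAl mxE. Qed.

Lemma dotZr a u v : dot u (a *: v) = a * dot u v.
Proof. by rewrite dotC dotZl dotC. Qed.

Lemma dotNl u v : dot (- u) v = - dot u v.
Proof. by rewrite -scaleN1r dotZl mulN1r. Qed.

Lemma dotNr u v : dot u (- v) = - dot u v.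
Proof. by rewrite dotC dotNl dotC. Qed.

Lemma dot0r u : dot u 0 = 0.
Proof. by rewrite -(scale0r 0) dotZr mul0r. Qed.

Lemma dot0l u : dot 0 u = 0.
Proof. by rewrite dotC dot0r. Qed.

Definition dot_lin := (dotDl, dotDr, dotNl, dotNr, dotZl, dotZr).

Lemma dot_sumr (I : finType) (F : I -> 'rV[R]_n) u :
  dot u (\sum_i F i) = \sum_i dot u (F i).
Proof.
by apply: (big_morph (dot u)) => [v w|]; [exact: dotDr|exact: dot0r].
Qed.

Lemma dot_ge0 u : 0 <= dot u u.
Proof. by rewrite dotE sumr_ge0// => i _; rewrite -expr2 sqr_ge0. Qed.

Lemma dot_eq0 u : (dot u u == 0) = (u == 0).
Proof.
apply/eqP/eqP => [|->]; last exact: dot0r.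
rewrite dotE => /psumr_eq0P h; apply/rowP => i; rewrite mxE.
have /eqP : u 0 i * u 0 i = 0 by apply: h => // j _; rewrite -expr2 sqr_ge0.
by rewrite mulf_eq0 orbb => /eqP.
Qed.

Lemma dot_gt0 u : (0 < dot u u) = (u != 0).
Proof. by rewrite lt0r dot_eq0 dot_ge0 andbT. Qed.

Lemma dotDD u v : dot (u + v) (u + v) = dot u u + 2 * dot u v + dot v v.
Proof. by rewrite !dot_lin (dotC v u); ring. Qed.

Lemma dotBB u v : dot (u - v) (u - v) = dot u u - 2 * dot u v + dot v v.
Proof. by rewrite !dot_lin (dotC v u); ring. Qed.

Lemma dotDD_le u v : dot (u + v) (u + v) <= 2 * dot u u + 2 * dot v v.
Proof.
have := dot_ge0 (u - v); rewrite !dot_lin (dotC v u); lra.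
Qed.

Lemma sqr_norm_le_dot u : `|u| ^+ 2 <= dot u u.
Proof.
have [->|u0] := eqVneq u 0; first by rewrite normr0 expr0n/= dot_ge0.
have [[i j] /=] : exists i, mx_norm u = `|u i.1 i.2|.
  by apply: mx_norm_neq0; rewrite -[mx_norm u]/(`|u|) normr_eq0.
rewrite -[mx_norm u]/(`|u|) => ->.
rewrite (ord1 i) real_normK ?num_real// dotE (bigD1 j)//= expr2 lerDl.
by rewrite sumr_ge0// => k _; rewrite -expr2 sqr_ge0.
Qed.

Lemma dot_continuous (T : topologicalType) (f g : T -> 'rV[R]_n) :
  continuous f -> continuous g -> continuous (fun x => dot (f x) (g x)).
Proof.
move=> cf cg x.
rewrite (_ : (fun x => _) = \sum_(i < n) (fun x => f x 0 i * g x 0 i)); last first.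
  by apply/funext => y; rewrite dotE fct_sumE.
elim/big_ind : _ => [||i _].
- exact: (@cst_continuous _ _ (0 : R) x).
- by move=> F G cF cG; exact: cvgD.
- have cc (h : T -> 'rV[R]_n) : continuous h -> {for x, continuous (fun x => h x 0 i)}.
    move=> ch; apply: (@continuous_comp _ _ _ h (fun M : 'rV[R]_n => M 0 i)).
      exact: ch.
    exact: coord_continuous.
  by apply: cvgM; exact: cc.
Qed.

Lemma dotl_continuous u : continuous (dot u).
Proof. by apply: (@dot_continuous _ (cst u) id) => x //; exact: cst_continuous. Qed.

Lemma dist_continuous (x : 'rV[R]_n) : continuous (fun z : 'rV[R]_n => dot (z - x) (z - x)).
Proof.
have cB : continuous (fun z : 'rV[R]_n => z - x).
  by move=> z; apply: (@cvgB _ _ _ (nbhs z) _ id (cst x)) => //; exact: cvg_cst.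
exact: dot_continuous.
Qed.

Lemma closed_dot_le u c : closed [set x | dot u x <= c].
Proof.
apply: (@preimage_closed _ _ (dot u) [set y | y <= c]); last exact: closed_le.
by move=> x _; exact: dotl_continuous.
Qed.

Lemma closed_dot_eq u c : closed [set x | dot u x = c].
Proof.
apply: (@preimage_closed _ _ (dot u) [set y | y = c]); last exact: closed_eq.
by move=> x _; exact: dotl_continuous.
Qed.

Lemma compact_max (A : set 'rV[R]_n) (f : 'rV[R]_n -> R) :
  compact A -> A !=set0 -> continuous f ->
  exists2 a, A a & forall x, A x -> f x <= f a.
Proof.
move=> cA A0 cf.
have [|a /set_mem Aa amax] := compact_EVT_max A0 cA (f := f).
  exact: continuous_subspaceT.
by exists a => // x Ax; apply: amax; exact: mem_set.
Qed.

End dot_product.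

(** * Convex combinations and nearest points *)

Section convex.
Context {R : realType} {n : nat}.
Implicit Types (A B : set 'rV[R]_n) (x y z : 'rV[R]_n).

Lemma convex_setP A : convex_set A <->
  forall x y (a b : R), A x -> A y -> 0 <= a -> 0 <= b -> a + b = 1 ->
    A (a *: x + b *: y).
Proof.
split=> [cA x y a b Ax Ay a0 b0 ab|cA x y k /set_mem Ax /set_mem Ay].
- have a1 : a <= 1 by lra.
  have /set_mem := cA x y (Itv01 a0 a1) (mem_set Ax) (mem_set Ay).
  by have -> : b = 1 - a by lra.
- apply: mem_set; rewrite /conv/=; apply: cA => //=.
  by rewrite /unstable.onem subr_ge0.
by rewrite /unstable.onem addrC subrK.
Qed.

(** Weights are not normalised, and points of weight zero may lie outside [A]; both occur in the
    Radon argument. *)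
Lemma convex_sum A (I : finType) (w : I -> R) (f : I -> 'rV[R]_n) :
  convex_set A -> (forall i, 0 <= w i) -> (forall i, 0 < w i -> A (f i)) ->
  0 < \sum_i w i -> exists2 p, A p & \sum_i w i *: f i = (\sum_i w i) *: p.
Proof.
move=> /convex_setP cA w0 Af W0.
suff [_ [p Ap ->]] : 0 <= \sum_i w i /\
    exists2 p, (0 < \sum_i w i -> A p) & \sum_i w i *: f i = (\sum_i w i) *: p.
  by exists p => //; exact: Ap.
elim/big_rec2 : _ => [|i S W _ [Wge0 [p Ap ->]]].
  by split=> //; exists 0; rewrite ?scale0r// ltxx.
split; first by rewrite addr_ge0.
have [wi0|wi0] := eqVneq (w i) 0.
  by exists p; rewrite ?wi0 ?scale0r ?add0r.
have {}wi0 : 0 < w i by rewrite lt0r wi0 w0.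
have [W_eq0|W_neq0] := eqVneq W 0.
  by exists (f i) => [_|]; [exact: Af|rewrite W_eq0 scale0r !addr0].
have {W_neq0}W_gt0 : 0 < W by rewrite lt0r W_neq0 Wge0.
have wW : 0 < w i + W by rewrite addr_gt0.
exists ((w i / (w i + W)) *: f i + (W / (w i + W)) *: p).
  move=> _; apply: cA; rewrite ?divr_ge0 ?ltW//; [exact: Af|exact: Ap|].
  by rewrite -mulrDl divff ?gt_eqF.
rewrite scalerDr !scalerA; by congr (_ *: _ + _ *: _); field; rewrite gt_eqF.
Qed.

Lemma nearest_point A x : compact A -> convex_set A -> A !=set0 ->
  exists2 p, A p & forall z, A z -> dot (x - p) (z - p) <= 0.
Proof.
move=> cA /convex_setP cvA A0.
have [|p Ap pmax] := compact_max (f := fun z => - dot (z - x) (z - x)) cA A0.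
  by move=> y; apply: (@cvgN _ _ _ (nbhs y)); exact: dist_continuous.
exists p => // z Az; rewrite leNgt; apply/negP => d0.
pose e := z - p; pose t := Num.min 1 (dot (x - p) e / (dot e e + 1)).
have e1 : 0 < dot e e + 1 by rewrite ltr_wpDl ?dot_ge0.
have t0 : 0 < t by rewrite lt_min ltr01 divr_gt0.
have t1 : t <= 1 by rewrite ge_min lexx.
have te : t * dot e e <= dot (x - p) e.
  have : t <= dot (x - p) e / (dot e e + 1) by rewrite ge_min lexx orbT.
  by rewrite ler_pdivlMr// mulrDr mulr1; lra.
have /pmax : A ((1 - t) *: p + t *: z).
  by apply: cvA => //; [lra|exact: ltW|lra].
have -> : (1 - t) *: p + t *: z - x = t *: e - (x - p).
  by rewrite /e scalerBr scalerBl scale1r; apply/rowP => i; rewrite !mxE; ring.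
have -> : dot (p - x) (p - x) = dot (x - p) (x - p) by rewrite -opprB !dot_lin; ring.
have closer (y f : 'rV[R]_n) : t * dot f f <= dot y f -> 0 < dot y f ->
    dot (t *: f - y) (t *: f - y) < dot y y.
  by rewrite !dot_lin (dotC f y) => *; nra.
by rewrite lerN2 leNgt closer.
Qed.

End convex.

(** * Minkowski differences, summands and cancellation *)

Section minkowski_difference.
Context {R : realType} {n : nat}.
Implicit Types (A K T : set 'rV[R]_n).

Lemma minkowski_diff_convex K T : convex_set K -> convex_set (minkowski_diff K T).
Proof.
move=> /convex_setP cK; apply/convex_setP => x y a b.
move=> /minkowski_diffP Kx /minkowski_diffP Ky a0 b0 ab.
apply/minkowski_diffP => t Tt; have -> : a *: x + b *: y + t = a *: (x + t) + b *: (y + t).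
  by rewrite !scalerDr addrACA -scalerDl ab scale1r.
by apply: cK => //; [exact: Kx|exact: Ky].
Qed.

Lemma minkowski_diff_compact K T :
  compact K -> T !=set0 -> compact (minkowski_diff K T).
Proof.
move=> cK [t Tt]; apply: bounded_closed_compact; last first.
  have -> : minkowski_diff K T = \bigcap_(t in T) ((fun x => x + t) @^-1` K).
    apply/seteqP; split=> x; first by move/minkowski_diffP.
    by move=> Kx; apply/minkowski_diffP.
  apply: closed_bigI => {t}{Tt}t Tt; apply: preimage_closed.
    by move=> x _; apply: (@cvgD _ _ _ (nbhs x) _ id (cst t)) => //; exact: cvg_cst.
  by apply: compact_closed => //; exact: norm_hausdorff.
have [M [Mr MK]] := compact_bounded cK.
exists (M + 1 + `|t|); split; first by rewrite !realD.
move=> r Mr' x /minkowski_diffP/(_ t Tt) Kxt /=.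
rewrite -[x](addrK t); apply: (le_trans (ler_normB _ _)).
have := MK (M + 1) _ _ Kxt; rewrite ltrDl ltr01 => /(_ isT) /=; lra.
Qed.

Lemma minkowski_diffS K T T' : T `<=` T' -> minkowski_diff K T' `<=` minkowski_diff K T.
Proof. by move=> TT' x h t /TT' /h. Qed.

(** This is K = A + (K (-) A), of which only the inclusion of [K] is not automatic. *)
Definition summand K A := forall k, K k -> exists2 a, A a & minkowski_diff K A (k - a).

(* Rådström's cancellation law. *)
Lemma minkowski_cancel (F T : set 'rV[R]_n) p :
  compact F -> F !=set0 -> compact T -> convex_set T ->
  (forall f, F f -> exists2 f', F f' & T (p + f - f')) -> T p.
Proof.
move=> cF F0 cT cvT pFT.
have T0 : T !=set0 by have [f /pFT [f' _ ?]] := F0; exists (p + f - f').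
have [q Tq qmin] := nearest_point p cT cvT T0.
have [w wE] : exists w, w = p - q by exists (p - q).
rewrite -wE in qmin.
(* With [f] maximising [w] on [F], the vector [f - f'] has non-negative product with [w], so the
   nearest-point inequality at [p + f - f'] leaves only [w = 0]. *)
have [f Ff fmax] := compact_max cF F0 (dotl_continuous (u := w)).
have [f' Ff' /qmin] := pFT f Ff.
have -> : p + f - f' - q = w + (f - f') by rewrite wE; apply/rowP=> i; rewrite !mxE; ring.
have := fmax f' Ff'; rewrite !dotDr dotNr => f'f d0.
have /eqP : dot w w = 0 by apply/eqP; rewrite eq_le dot_ge0 andbT; lra.
by rewrite dot_eq0 wE subr_eq0 => /eqP ->.
Qed.

End minkowski_difference.

(** * Affine dimension and a Carathéodory theorem for intersections *)

Section affine_dimension.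
Context {R : realType} {n : nat}.
Implicit Types (K P G : set 'rV[R]_n).

Definition lin_indep (J : finType) (v : J -> 'rV[R]_n) : Prop :=
  forall w : J -> R, \sum_j w j *: v j = 0 -> forall j, w j = 0.

Lemma sum_option (V : nmodType) (J : finType) (F : option J -> V) :
  \sum_o F o = F None + \sum_j F (Some j).
Proof.
rewrite (bigD1 None)//=; congr (_ + _).
rewrite (reindex_omap Some id)/=; last by case.
by apply: eq_bigl => j; rewrite eqxx.
Qed.

Definition adim_le P (d : nat) : Prop :=
  forall (J : finType) (g : J -> 'rV[R]_n) f, P f -> (forall j, P (g j)) ->
    lin_indep (fun j => g j - f) -> (#|J| <= d)%N.

Lemma lin_indep_card (J : finType) (v : J -> 'rV[R]_n) :
  lin_indep v -> (#|J| <= n)%N.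
Proof.
move=> iv; pose A := \matrix_(i < #|J|) v (enum_val i).
suff /eqP <- : row_free A by exact: rank_leq_col.
rewrite -kermx_eq0; apply/eqP/row_matrixP => k; rewrite row0.
have /sub_kermxP : (row k (kermx A) <= kermx A)%MS by exact: row_sub.
move: (row k _) => w; rewrite mulmx_sum_row => w0.
apply/rowP => i; rewrite mxE -(enum_valK i).
apply: (iv (fun j => w 0 (enum_rank j))).
rewrite -[RHS]w0 (reindex _ (onW_bij _ (@enum_val_bij J))).
by apply: eq_bigr => j _; rewrite rowK enum_valK.
Qed.

Lemma adim_le_full P : adim_le P n.
Proof. by move=> J g f _ _; exact: lin_indep_card. Qed.

(** The point [k] off the hyperplane extends any affinely independent family of [G] to one of
    [K]. *)
Lemma adim_face K G N u c k : adim_le K N -> G `<=` K ->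
  (forall g, G g -> dot u g = c) -> K k -> dot u k != c ->
  forall (J : finType) (g : J -> 'rV[R]_n) f, G f -> (forall j, G (g j)) ->
    lin_indep (fun j => g j - f) -> (#|J| < N)%N.
Proof.
move=> KN GK Gc Kk kc J g f Gf Gg ig; rewrite -card_option.
apply: (KN _ (fun o => if o is Some j then g j else k) f); first exact: GK.
  by case=> [j|//]; exact: GK.
move=> w w0.
have wN : w None = 0.
  have /eqP : dot u (\sum_o w o *: ((if o is Some j then g j else k) - f)) = 0.
    by rewrite w0 dot0r.
  rewrite dot_sumr sum_option/= big1 ?addr0.
    by rewrite dotZr dotDr dotNr (Gc f)// mulf_eq0 subr_eq0 (negbTE kc) orbF => /eqP.
  by move=> j _; rewrite dotZr dotDr dotNr (Gc f)// (Gc (g j))// subrr mulr0.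
case=> [j|//]; apply: (ig (fun j => w (Some j))).
by move: w0; rewrite sum_option/= wN scale0r add0r.
Qed.

Definition cell (I : finType) P (C : I -> set 'rV[R]_n) (Y : {set I}) : set 'rV[R]_n :=
  [set x | P x /\ forall i, i \in Y -> C i x].

Lemma cell_convex (I : finType) P (C : I -> set 'rV[R]_n) Y :
  convex_set P -> (forall i, convex_set (C i)) -> convex_set (cell P C Y).
Proof.
move=> /convex_setP cP cC; apply/convex_setP => x y a b [Px Cx] [Py Cy] a0 b0 ab.
split; first exact: cP.
by move=> i iY; apply: (convex_setP _).1 => //; [exact: Cx|exact: Cy].
Qed.

Lemma cell_compact (I : finType) P (C : I -> set 'rV[R]_n) Y :
  compact P -> (forall i, compact (C i)) -> compact (cell P C Y).
Proof.
move=> cP cC; have -> : cell P C Y = P `&` \bigcap_(i in [set i | i \in Y]) C i.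
  by apply/seteqP; split.
apply: compact_closedI => //; apply: closed_bigI => i _.
by apply: compact_closed => //; exact: norm_hausdorff.
Qed.

Lemma cellS (I : finType) P (C : I -> set 'rV[R]_n) (Y Z : {set I}) :
  Y \subset Z -> cell P C Z `<=` cell P C Y.
Proof. by move=> /fintype.subsetP YZ x [Px Cx]; split=> // i /YZ; exact: Cx. Qed.

(** For each [z] in [Z], minimality yields a point above level [c] that satisfies all constraints of
    [Z] but that of [z]. These points, the [g j] and [f] are affinely independent: a dependency
    would give a Radon point in the cell of [Z] above level [c]. *)
Lemma adim_minimal_cell (I : finType) P (C : I -> set 'rV[R]_n) (Z : {set I}) u c d :
  convex_set P -> (forall i, convex_set (C i)) -> adim_le P d ->
  (forall x, cell P C Z x -> dot u x <= c) ->
  (forall z, z \in Z -> exists2 s, cell P C (Z :\ z)%SET s & c < dot u s) ->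
  forall (J : finType) (g : J -> 'rV[R]_n) f,
    cell P C Z f -> dot u f = c ->
    (forall j, cell P C Z (g j)) -> (forall j, dot u (g j) = c) ->
    lin_indep (fun j => g j - f) -> (#|Z| + #|J| <= d)%N.
Proof.
move=> cP cC Pd Zc Zmin J g f Zf uf Zg ug ig.
have /choice[s sP] : forall z, exists s, z \in Z -> cell P C (Z :\ z)%SET s /\ c < dot u s.
  move=> z; case: (boolP (z \in Z)) => [/Zmin[s]|_]; last by exists 0.
  by exists s.
pose K := ({z | z \in Z} + J)%type.
pose h (k : K) := match k with inl z => s (val z) | inr j => g j end.
have <- : #|{: K}| = (#|Z| + #|J|)%N by rewrite card_sum card_sig.
have Ph k : P (h k).
  by case: k => [[z zZ]|j] /=; [have [[]] := sP z zZ|have [] := Zg j].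
have uh k : c <= dot u (h k).
  by case: k => [[z zZ]|j] /=; [have [_ /ltW] := sP z zZ|rewrite ug].
apply: (Pd _ h f) => //; first by case: Zf.
move=> w w0.
(* Split the dependency by the signs of [w], putting the missing weight on [f]:
   the two resulting convex combinations coincide, and each [C i] with [i \in Z]
   contains all points of one of them. *)
pose wp (e : R) (o : option K) := if o is Some k then Num.max (e * w k) 0
                                  else \sum_k Num.max (- e * w k) 0.
pose hh o := if o is Some k then h k else f.
have wp_ge0 e o : 0 <= wp e o.
  by case: o => [k|] /=; [|apply: sumr_ge0 => k _]; rewrite le_max lexx orbT.
have maxB (x : R) : Num.max x 0 - Num.max (- x) 0 = x.
  by case: (lerP x 0) => ?; case: (lerP (- x) 0) => ?; lra.
have sumwp : \sum_o wp 1 o = \sum_o wp (-1) o.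
  by rewrite !sum_option /= addrC opprK.
have sumwph : \sum_o wp 1 o *: hh o = \sum_o wp (-1) o *: hh o.
  apply/eqP; rewrite -subr_eq0 -sumrB sum_option /=.
  rewrite opprK -scalerBl -sumrB.
  rewrite -[X in _ == X]w0 addrC scaler_suml -big_split/=; apply/eqP/eq_bigr => k _.
  rewrite mul1r mulN1r -scalerBl maxB -opprB maxB scaleNr scalerBr.
  by rewrite addrC.
have [/existsP[z wz]|/existsPn wz] := boolP [exists z, w (inl z) != 0]; last first.
  have {}wz z : w (inl z) = 0 by apply/eqP; rewrite -[_ == _]negbK wz.
  case=> [z|j]; first exact: wz.
  apply: (ig (fun j => w (inr j))); move: w0.
  rewrite big_sumType/= big1 ?add0r// => z _; by rewrite wz scale0r.
exfalso.
pose W := \sum_o wp 1 o; pose S := \sum_o wp 1 o *: hh o; pose r := W^-1 *: S.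
have sumwp' e : e = 1 \/ e = -1 -> \sum_o wp e o = W /\ \sum_o wp e o *: hh o = S.
  by case=> ->.
have [e e1 ez] : exists2 e, e = 1 \/ e = -1 & 0 < wp e (Some (inl z)).
  have [wz0|wz0] := ltrP 0 (w (inl z)).
    by exists 1; [left|rewrite /= mul1r lt_max wz0].
  exists (-1); [by right|rewrite /= mulN1r lt_max oppr_gt0].
  by rewrite lt_neqAle wz wz0.
have W0 : 0 < W.
  have [<- _] := sumwp' e e1.
  by rewrite (bigD1 (Some (inl z)))//= ltr_wpDr// sumr_ge0// => o _; exact: wp_ge0.
have in_r e' (D : set 'rV[R]_n) : e' = 1 \/ e' = -1 -> convex_set D ->
    (forall o, 0 < wp e' o -> D (hh o)) -> D r.
  move=> /sumwp'[We Se] cD Dh.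
  have [|||p Dp] := convex_sum (w := wp e') (f := hh) cD.
  - exact: wp_ge0.
  - exact: Dh.
  - by rewrite We.
  rewrite We Se /r => ->; rewrite scalerA mulVf ?scale1r// gt_eqF//.
have in_C e' i (iZ : i \in Z) : e' * w (inl (exist _ i iZ)) <= 0 ->
    forall o, 0 < wp e' o -> C i (hh o).
  move=> wi; case=> [[[z' z'Z]|j]|] /= wo; last 2 first.
  - by have [_ /(_ i iZ)] := Zg j.
  - by have [_ /(_ i iZ)] := Zf.
  have [iz'|iz'] := eqVneq i z'.
    move: wo; subst z'; rewrite (bool_irrelevance z'Z iZ) lt_max ltxx orbF.
    by move/(le_lt_trans wi); rewrite ltxx.
  by have [[_ +] _] := sP z' z'Z; apply; rewrite !inE iz'.
have Zr : cell P C Z r.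
  split; first by apply: (in_r 1 P (or_introl erefl) cP); case=> [k|] _; [exact: Ph|case: Zf].
  move=> i iZ; have [wi|wi] := lerP (w (inl (exist _ i iZ))) 0.
    by apply: (in_r 1 _ (or_introl erefl) (cC i)); apply: (in_C 1 i iZ); rewrite mul1r.
  by apply: (in_r (-1) _ (or_intror erefl) (cC i)); apply: (in_C _ i iZ); rewrite mulN1r oppr_le0 ltW.
have := Zc r Zr; apply/negP; rewrite -ltNge.
(* At [r] the functional is a weighted mean of values at least [c], and the value at [s z], of
   positive weight, exceeds [c]. *)
have -> : dot u r = W^-1 * \sum_o wp e o * dot u (hh o).
  have [_ Se] := sumwp' e e1; rewrite /r -Se dotZr dot_sumr.
  by congr (_ * _); apply: eq_bigr => o _; rewrite dotZr.
rewrite mulrC ltr_pdivlMr// mulrC; have [<- _] := sumwp' e e1.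
rewrite -subr_gt0 mulr_suml -sumrB (bigD1 (Some (inl z)))//=.
apply: ltr_wpDr.
  apply: sumr_ge0 => o _; rewrite -mulrBr mulr_ge0// subr_ge0.
  by case: o => [k|] //=; rewrite uf.
rewrite -mulrBr mulr_gt0// subr_gt0.
by case: (z) => z' z'Z /=; have [] := sP z' z'Z.
Qed.

(** The induction is on [N]: a face of [K] has smaller dimension, and passing to a face of the cell
    of [Z] leaves [d - #|Z|] indices to the recursive call. *)
Theorem cell_caratheodory (N : nat) (K P : set 'rV[R]_n) (I : finType)
    (C : I -> set 'rV[R]_n) (d : nat) (q : 'rV[R]_n) :
  compact K -> convex_set K -> compact P -> convex_set P ->
  (forall i, compact (C i)) -> (forall i, convex_set (C i)) ->
  cell P C [set: I]%SET !=set0 -> (forall Y, summand K (cell P C Y)) ->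
  adim_le K N -> adim_le P d -> minkowski_diff K (cell P C [set: I]%SET) q ->
  exists2 Y : {set I}, (#|Y| <= d)%N & minkowski_diff K (cell P C Y) q.
Proof.
elim/ltn_ind: N K P C d q => N IH K P C d q cK vK cP vP cC vC [a0 Aa0] sK KN Pd Bq.
pose D Y := cell P C Y; pose B := minkowski_diff K (D [set: I]%SET).
have cD Y : compact (D Y) by exact: cell_compact.
have vD Y : convex_set (D Y) by exact: cell_convex.
have DT Y : D [set: I]%SET `<=` D Y by apply: cellS; exact: finset.subsetT.
have cB : compact B by apply: minkowski_diff_compact => //; exists a0.
have vB : convex_set B by exact: minkowski_diff_convex.
(* Since [P] itself is a summand, K (-) P contains a point [b]; it lies in K (-) D_Y for every
   [Y]. *)
have [b bP] : exists b, forall Y, minkowski_diff K (D Y) b.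
  have [|a _ Ka] := sK finset.set0 (q + a0).
    by move/minkowski_diffP : Bq; exact.
  exists (q + a0 - a) => Y; apply: minkowski_diffS Ka.
  by move=> x [Px _]; split=> // i; rewrite inE.
(* First case: [p] maximises on [B] a functional whose value at [b] is smaller. *)
have expose p u : B p -> (forall x, B x -> dot u x <= dot u p) -> dot u b < dot u p ->
    exists2 Y : {set I}, (#|Y| <= d)%N & minkowski_diff K (D Y) p.
  move=> /minkowski_diffP Bp umax ub.
  have [a Aa amax] := compact_max (cD [set: I]%SET) (ex_intro _ a0 Aa0) (dotl_continuous (u := u)).
  pose c := dot u a.
  have /ex_minset[Z /minsetP[/asboolP Zc Zmin]] :
      exists Z : {set I}, `[< forall x, D Z x -> dot u x <= c >].
    by exists [set: I]%SET; apply/asboolP.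
  have {}Zmin z : z \in Z -> exists2 s, D (Z :\ z)%SET s & c < dot u s.
    move=> zZ; apply: contrapT => nos.
    have /Zmin : `[< forall x, D (Z :\ z)%SET x -> dot u x <= c >].
      apply/asboolP => x Dx; rewrite leNgt; apply/negP => cx; apply: nos.
      by exists x.
    move=> /(_ (subD1set _ _))/setP/(_ z); by rewrite !inE eqxx zZ.
  (* The maxima of [u] on [D Z], [B] and [K] are [c], [dot u p] and their sum; [P'] and [G] are the
     faces of [D Z] and [K]. *)
  pose P' := [set x | D Z x /\ dot u x = c].
  pose G := [set x | K x /\ dot u x = c + dot u p].
  have cellP' Y x : cell P' C Y x <-> D (Z :|: Y)%SET x /\ dot u x = c.
    split=> [[[[Px Zx] ux] Yx]|[[Px ZYx] ux]].
      by do 2![split=> //] => i; rewrite inE => /orP[/Zx|/Yx].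
    split=> [|i iY]; last by apply: ZYx; rewrite inE iY orbT.
    by do 2![split=> //] => i iZ; apply: ZYx; rewrite inE iZ.
  have a_cell Y : cell P' C Y a by apply/cellP'; split=> //; exact: DT.
  (* A point of [G] splits into parts with values at most [c] and [dot u p]; their sum forces
     equality in both. *)
  have split_face Y g : G g -> exists2 a', cell P' C Y a' &
      minkowski_diff K (D (Z :|: Y)%SET) (g - a') /\ dot u (g - a') = dot u p.
    move=> [Kg ug]; have [a' Da' Ka'] := sK (Z :|: Y)%SET g Kg.
    have ua' : dot u a' <= c by apply/Zc/(cellS (finset.subsetUl Z Y)).
    have : dot u (g - a') <= dot u p by apply: umax; exact: minkowski_diffS Ka'.
    rewrite dotDr dotNr ug => ga'.
    have ua'c : dot u a' = c by lra.
    exists a'; first exact/cellP'.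
    by split=> //; rewrite dotDr dotNr ug ua'c; lra.
  have closed_face v e (F : set 'rV[R]_n) :
      compact F -> compact [set x | F x /\ dot v x = e].
    move=> cF; apply: (compact_closedI (B := [set x | dot v x = e]) cF).
    exact: closed_dot_eq.
  have convex_face v e (F : set 'rV[R]_n) :
      convex_set F -> convex_set [set x | F x /\ dot v x = e].
    move=> /convex_setP cF; apply/convex_setP => x y s t [Fx vx] [Fy vy] s0 t0 st.
    by split; [exact: cF|rewrite !dot_lin vx vy -mulrDl st mul1r].
  (* The point [b + a] of [K] lies off the hyperplane of [G], so [G] has smaller dimension. *)
  have Kab : K (b + a) by move: (bP [set: I]%SET) => /minkowski_diffP; exact.
  have uab : dot u (b + a) != c + dot u p.
    by rewrite dotDr addrC (inj_eq (addrI _)) lt_eqF.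
  have Gpa : G (p + a) by split; [exact: Bp|rewrite dotDr addrC].
  have GN := adim_face KN (fun x (Gx : G x) => Gx.1) (fun x (Gx : G x) => Gx.2) Kab uab.
  have N0 : (0 < N)%N.
    have := GN void (fun=> 0) _ Gpa; rewrite card_void.
    by apply=> [[]|w _ []].
  have Zd := adim_minimal_cell vP vC Pd Zc Zmin.
  have P'a : P' a by split=> //; exact: DT.
  have Zled : (#|Z| <= d)%N.
    have := Zd void (fun=> 0) a P'a.1 P'a.2; rewrite card_void addn0.
    by apply=> [[]|[]|w _ []].
  have [||||||||||||Y Yd GY] := IH N.-1 _ G P' C (d - #|Z|)%N p; rewrite ?prednK//.
  - exact: closed_face.
  - exact: convex_face.
  - exact: closed_face.
  - exact: convex_face.
  - by exists a.
  - move=> Y g Gg; have [a' a'Y [Ka' ua']] := split_face Y g Gg.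
    exists a' => //; apply/minkowski_diffP => t /cellP'[Dt ut]; split.
      by move/minkowski_diffP : Ka'; exact.
    by rewrite dotDr ua' ut addrC.
  - by move=> J g f Gf Gg ig; rewrite -ltnS prednK//; exact: GN Gf Gg ig.
  - move=> J g f [Df uf] P'g ig; rewrite leq_subRL//.
    by apply: (Zd _ g f) => // j; case: (P'g j).
  - apply/minkowski_diffP => t /cellP'[Dt ut]; split; last by rewrite dotDr ut addrC.
    by apply: Bp; rewrite finset.setUT in Dt.
  exists (Z :|: Y)%SET.
    by rewrite (leq_trans (leq_card_setU _ _))// -leq_subRL.
  (* By the choice of [Y], [p] plus any [f] in the face lies in [G] and splits again; cancelling the
     face leaves [p] in K (-) D_(Z u Y). *)
  suff : [set x | minkowski_diff K (D (Z :|: Y)%SET) x /\ dot u x = dot u p] p by case.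
  apply: (@minkowski_cancel _ _ (cell P' C Y)).
  - by apply: cell_compact => //; exact: closed_face.
  - by exists a.
  - apply: closed_face; apply: minkowski_diff_compact => //.
    by exists a; exact: DT.
  - by apply: convex_face; exact: minkowski_diff_convex.
  - move=> f Yf; apply: split_face.
    by move/minkowski_diffP : GY; exact.
pose S := [set x | exists2 Y : {set I}, (#|Y| <= d)%N & minkowski_diff K (D Y) x].
have clS : closed S.
  have -> : S = \bigcup_(Y in [set Y : {set I} | (#|Y| <= d)%N]) minkowski_diff K (D Y).
    by apply/seteqP; split=> x [Y ? ?]; exists Y.
  apply: closed_bigcup => [|Y _]; first exact: finite_finset.
  apply: compact_closed; first exact: norm_hausdorff.
  apply: minkowski_diff_compact => //; exists a0; exact: DT.
apply: contrapT; rewrite -/(S q) => nSq.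
(* [S] is star-shaped about [b], so if [q] is outside [S], the ray from [b] stays outside from [q]
   on. *)
have star x t : S x -> 0 <= t <= 1 -> S ((1 - t) *: b + t *: x).
  move=> [Y Yd Yx] /andP[t0 t1]; exists Y => //.
  have /convex_setP vKD := minkowski_diff_convex (T := D Y) vK.
  by apply: vKD => //; lra.
pose v := q - b.
have v0 : 0 < dot v v.
  rewrite dot_gt0 subr_eq0; apply/eqP => qb; apply: nSq; exists finset.set0.
    by rewrite cards0.
  by rewrite qb.
pose ray t := b + t *: v.
have ray_cont : continuous ray.
  move=> t; apply: (@cvgD _ _ _ (nbhs t) _ (cst b)); first exact: cvg_cst.
  exact: scalel_continuous.
have [T [T0 RT]] : exists T, 0 <= T /\ forall t, B (ray t) -> t <= T.
  have [m Bm mmax] := compact_max cB (ex_intro _ q Bq) (dotl_continuous (u := v)).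
  have mb : dot v b <= dot v m by apply: mmax; exact: bP.
  exists ((dot v m - dot v b) / dot v v); split.
    by rewrite divr_ge0 ?subr_ge0// ltW.
  move=> t /mmax; rewrite ler_pdivlMr// dotDr dotZr; lra.
pose E := [set t | 0 <= t /\ B (ray t)].
have cE : compact E.
  have -> : E = `[0, T] `&` ray @^-1` B.
    apply/seteqP; split=> t /=; rewrite in_itv/=.
      by move=> [t0 Bt]; rewrite t0 RT.
    by move=> [/andP[]].
  apply: compact_closedI; first exact: segment_compact.
  apply: preimage_closed => [t _|]; first exact: ray_cont.
  by apply: compact_closed => //; exact: norm_hausdorff.
have E1 : E 1 by split=> //; rewrite /ray scale1r addrC subrK.
(* [ray s] is where the ray from [b] through [q] leaves [B]. *)
have [s /set_mem[s0 Bs] smax] : exists2 c, c \in E & forall t, t \in E -> t <= c.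
  apply: (compact_EVT_max (f := id)) => //; first by exists 1.
  by apply: continuous_subspaceT => t.
have s1 : 1 <= s by apply: smax; exact: mem_set.
have nSs : ~ S (ray s).
  move=> /(star _ s^-1); rewrite invr_ge0 s0 invf_le1 ?(lt_le_trans _ s1)// s1.
  move=> /(_ isT); have -> : (1 - s^-1) *: b + s^-1 *: ray s = q; last by [].
  rewrite /ray /v scalerDr scalerA mulVf ?scale1r; last first.
    by rewrite gt_eqF// (lt_le_trans _ s1).
  by rewrite addrA -scalerDl subrK scale1r addrC subrK.
have /nbhs_ballP[e /= e0 eS] : nbhs (ray s) (~` S).
  by apply: open_nbhs_nbhs; split => //; exact: closed_openC.
pose w := e / (1 + dot v v).
have w0 : 0 < w by rewrite divr_gt0// addr_gt0.
have we : w ^+ 2 * dot v v < e ^+ 2.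
  rewrite /w expr_div_n mulrAC ltr_pdivrMr ?exprn_gt0 ?addr_gt0//.
  by rewrite ltr_pM2l ?exprn_gt0//; nra.
pose x := ray (s + w).
have nBx : ~ B x.
  move=> Bx; have : E (s + w) by split=> //; lra.
  by move=> /mem_set/smax; lra.
have [p Bp pmin] := nearest_point x cB vB (ex_intro _ q Bq).
pose u := x - p; have u0 : 0 < dot u u.
  by rewrite dot_gt0 subr_eq0; apply/eqP => xp; apply: nBx; rewrite xp.
have xE : x = p + u by rewrite /u addrC subrK.
have xv : x = b + (s + w) *: v by [].
have umax y : B y -> dot u y <= dot u p.
  by move/pmin; rewrite -/u !dot_lin; lra.
(* [u] is larger at [x] than at [ray s], so it increases along the ray; hence its value at [b] is
   below that at [ray s], which is at most [dot u p]. *)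
have ub : dot u b < dot u p.
  rewrite ltNge; apply/negP => pb.
  have := umax _ Bs; rewrite /ray dotDr dotZr => us.
  have : dot u x = dot u p + dot u u by rewrite xE dotDr.
  rewrite xv dotDr dotZr; nra.
have [Y Yd Yp] := expose p u Bp umax ub.
have : ~ S p; last by apply; exists Y.
apply: eS; rewrite mx_norm_ball /ball_/=.
rewrite -(@ltr_pXn2r _ 2)// ?nnegrE//; last exact: ltW.
apply: (le_lt_trans (sqr_norm_le_dot _)); apply: le_lt_trans we.
(* As [dot u f <= 0], the projection [p] is no further from [ray s] than [x] is, hence outside
   [S]. *)
pose f := ray s - p.
have uf : dot u f <= 0 by rewrite /f dotDr dotNr subr_le0; exact: umax.
have wE : w *: v = u - f.
  by rewrite /u /f /x /ray; apply/rowP => i; rewrite !mxE; ring.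
have <- : dot (w *: v) (w *: v) = w ^+ 2 * dot v v by rewrite dotZl dotZr mulrA -expr2.
by rewrite -/f wE (dotBB u f); have := dot_ge0 u; lra.
Qed.

End affine_dimension.

(** * The pointed Carathéodory theorem for generating sets *)

Section generating.
Context {R : realType} {n : nat}.
Implicit Types (K T : set 'rV[R]_n).

Lemma generating_summand K T : generating_set K ->
  T !=set0 -> minkowski_diff K T !=set0 -> summand K (minkowski_diff K T).
Proof.
move=> [_ gK] T0 KT0 k Kk; have [T' _ KTT'] := gK T T0 KT0.
move: (Kk); rewrite -{1}KTT' => -[a KTa [t T't <-]]; exists a => //.
apply/minkowski_diffP => a' KTa'; rewrite (addrC a t) addrK addrC.
by rewrite -KTT'; exists a' => //; exists t.
Qed.

Lemma minkowski_diff_imageP (I : finType) K (f : I -> 'rV[R]_n) (Y : {set I}) x :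
  minkowski_diff K (f @` [set` Y]) x <-> forall i, i \in Y -> K (x + f i).
Proof.
split=> [/minkowski_diffP Kx i iY|Kx]; first by apply: Kx; exists i.
by apply/minkowski_diffP => _ [i iY <-]; exact: Kx.
Qed.

Lemma sconv_hullS K T T' : T `<=` T' -> sconv_hull K T `<=` sconv_hull K T'.
Proof. by move=> TT'; do 2!apply: minkowski_diffS. Qed.

(** The translate belonging to [p] serves as [P], so [p] enters every cell for free and [n] further
    indices suffice. *)
Lemma generating_caratheodory (I : finType) K (f : I -> 'rV[R]_n) (W : {set I}) p y :
  generating_set K -> p \in W -> minkowski_diff K (f @` [set` W]) !=set0 ->
  sconv_hull K (f @` [set` W]) y ->
  exists Y : {set I}, [/\ Y \subset W, p \in Y, (#|Y| <= n.+1)%N &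
    sconv_hull K (f @` [set` Y]) y].
Proof.
move=> gK pW [s Ws] Wy.
have [[cK vK _] _] := gK.
pose P := minkowski_diff K [set f p].
(* Indices outside [W] repeat the constraint of [p] and so add nothing. *)
pose C i := minkowski_diff K [set f (if i \in W then i else p)].
have PE x : P x <-> K (x + f p).
  split=> [/minkowski_diffP|Kx]; first exact.
  by apply/minkowski_diffP => _ ->.
have cellE (Y : {set I}) : cell P C Y = minkowski_diff K (f @` [set` (p |: Y :&: W)%SET]).
  apply/seteqP; split=> x.
    move=> [/PE Px Cx]; apply/minkowski_diff_imageP => i.
    rewrite !inE => /orP[/eqP ->//|/andP[iY iW]].
    by have /minkowski_diffP := Cx i iY; rewrite iW; exact.
  move/minkowski_diff_imageP => Kx; split.
    by apply/PE/Kx; rewrite !inE eqxx.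
  move=> i iY; apply/minkowski_diffP => _ ->; case: ifPn => iW; apply: Kx.
    by rewrite !inE iY iW orbT.
  by rewrite !inE eqxx.
have sub_W (Y : {set I}) : (p |: Y :&: W \subset W)%SET.
  by rewrite finset.subUset finset.sub1set pW finset.subsetIr.
have cell0 (Y : {set I}) : cell P C Y s.
  rewrite cellE; apply: minkowski_diffS Ws => _ [i iY <-]; exists i => //.
  exact: (fintype.subsetP (sub_W Y)).
have [|||||||||||Y Yn Yy] := @cell_caratheodory R n n K P I C n y.
- exact: cK.
- exact: vK.
- by apply: minkowski_diff_compact => //; exists (f p).
- exact: minkowski_diff_convex.
- by move=> i; apply: minkowski_diff_compact => //; eexists.
- by move=> i; exact: minkowski_diff_convex.
- by exists s.
- move=> Y; rewrite cellE; apply: generating_summand => //.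
    by exists (f p), p; rewrite //= !inE eqxx.
  by rewrite -cellE; exists s.
- exact: adim_le_full.
- exact: adim_le_full.
- by rewrite cellE finset.setTI (finset.setUidPr _) ?finset.sub1set.
exists (p |: Y :&: W)%SET; split; first exact: sub_W.
- by rewrite !inE eqxx.
- rewrite cardsU1 (leq_trans (leq_add (leq_b1 _) (subset_leq_card (finset.subsetIl _ _))))//.
- by rewrite /sconv_hull -cellE.
Qed.

End generating.

(** * Combining two Carathéodory properties on one index set *)

Section exchange.
Variable I : finType.
Implicit Types (phi : {set I} -> Prop) (A B W Y : {set I}).

(** [phi Y] abstracts the condition that a fixed point lies in the hull of the points indexed by
    [Y]. *)
Definition pointed_caratheodory phi d := forall W p, p \in W -> phi W ->
  exists Y, [/\ Y \subset W, p \in Y, (#|Y| <= d.+1)%N & phi Y].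

Definition monotone_family phi := forall A B, A \subset B -> phi A -> phi B.

(** Reduce [a |: B] to a set [B'] containing [a]. If [B'] still contains [p], it shares [a] and [p]
    with [A], so the union has at most (l + 1) + (m + 1) - 2 elements; if not, [p] has been replaced
    by [a]. *)
Lemma exchange_point phi1 phi2 l m A B p a :
  monotone_family phi1 -> monotone_family phi2 -> pointed_caratheodory phi2 m ->
  phi1 A -> phi2 B -> p \in A -> a \in A -> a != p ->
  (#|A| <= l.+1)%N ->
  (exists Y, [/\ (#|Y| <= l + m)%N, phi1 Y & phi2 Y]) \/ phi2 (a |: B :\ p)%SET.
Proof.
move=> mono1 mono2 pt2 A1 B2 pA aA ap Al.
have [|B' [B'aB aB' B'm B'2]] := pt2 (a |: B)%SET a (setU11 _ _).
  by apply: mono2 B2; exact: finset.subsetUr.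
have [pB'|pB'] := boolP (p \in B'); last first.
  right; apply: mono2 B'2; apply/fintype.subsetP => i iB'; rewrite !inE.
  have := fintype.subsetP B'aB i iB'; rewrite !inE => /orP[->//|->].
  by rewrite andbT (contraNneq _ pB') ?orbT// => <-.
left; exists (A :|: B')%SET; split.
- have : (2 <= #|A :&: B'|)%N.
    have <- : #|[set a; p]%SET| = 2%N by rewrite cards2 ap.
    apply: subset_leq_card; apply/fintype.subsetP => i; rewrite !inE.
    by move=> /orP[]/eqP ->; apply/andP.
  have := cardsUI A B'; lia.
- by apply: mono1 A1; exact: finset.subsetUl.
- by apply: mono2 B'2; exact: finset.subsetUr.
Qed.

Lemma joint_caratheodory phi1 phi2 l m (p : I) : (0 < l)%N -> (0 < m)%N ->
  monotone_family phi1 -> monotone_family phi2 ->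
  pointed_caratheodory phi1 l -> pointed_caratheodory phi2 m ->
  phi1 [set: I]%SET -> phi2 [set: I]%SET ->
  exists Y, [/\ (#|Y| <= l + m)%N, phi1 Y & phi2 Y].
Proof.
move=> l0 m0 mono1 mono2 pt1 pt2 T1 T2.
have [A [_ pA Al A1]] := pt1 _ p (finset.in_setT p) T1.
have [B [_ pB Bm B2]] := pt2 _ p (finset.in_setT p) T2.
(* If [A] is just [p], then [A] lies in [B], and m + 1 <= l + m because [l] is positive. *)
have [A0|[a]] := set_0Vmem (A :\ p)%SET.
  exists B; split=> //; first by lia.
  apply: mono1 A1; rewrite -(finset.setD1K pA) A0 finset.setU0 finset.sub1set//.
rewrite !inE => /andP[ap aA].
have [B0|[b]] := set_0Vmem (B :\ p)%SET.
  exists A; split=> //; first by lia.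
  apply: mono2 B2; rewrite -(finset.setD1K pB) B0 finset.setU0 finset.sub1set//.
rewrite !inE => /andP[bp bB].
have [//|B'2] := exchange_point mono1 mono2 pt2 A1 B2 pA aA ap Al.
have [[Y [Yml Y2 Y1]]|A'1] := exchange_point mono2 mono1 pt1 B2 A1 pB bB bp Bm.
  by exists Y; rewrite addnC.
(* Both conditions survive without [p]. As [A] and [B] share [p], their union has at most l + m + 1
   elements, and dropping [p] leaves l + m. *)
exists ((A :|: B) :\ p)%SET; split.
- have : (0 < #|A :&: B|)%N by apply/card_gt0P; exists p; rewrite inE pA pB.
  have := cardsUI A B; have := cardsD1 p (A :|: B)%SET; rewrite inE pA/=; lia.
- apply: mono1 A'1; apply/fintype.subsetP => i; rewrite !inE.
  by move=> /orP[/eqP ->|/andP[-> ->]//]; rewrite bp bB orbT.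
- apply: mono2 B'2; apply/fintype.subsetP => i; rewrite !inE.
  by move=> /orP[/eqP ->|/andP[-> ->]//]; rewrite ?ap ?aA ?orbT.
Qed.

End exchange.

Lemma card_le_finset (I : finType) (Y : {set I}) : ([set` Y] #<= `I_#|Y|)%card.
Proof.
have [->|[i0 _]] := set_0Vmem Y.
  by rewrite (_ : [set` _] = set0) ?card_ge0// -subset0 => i /=; rewrite inE.
apply: (card_le_trans _ (card_image_le (nth i0 (enum Y)) _)).
apply: subset_card_le => i iY; exists (index i (enum Y)).
  by rewrite /= cardE index_mem mem_enum.
by rewrite nth_index ?mem_enum.
Qed.

(** * Hulls in a product and the upper bound *)

Section product.
Context {R : realType} {l m : nat}.
Implicit Types (L : set 'rV[R]_l) (M : set 'rV[R]_m) (T : set 'rV[R]_(l + m)).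

Lemma set_row_mxP L M z : set_row_mx L M z <-> L (lsubmx z) /\ M (rsubmx z).
Proof.
split=> [[x Lx [y My <-]]|[Lz Mz]]; first by rewrite row_mxKl row_mxKr.
by exists (lsubmx z) => //; exists (rsubmx z) => //; rewrite hsubmxK.
Qed.

Lemma minkowski_diff_row_mx L M T s :
  minkowski_diff (set_row_mx L M) T s <->
  minkowski_diff L (lsubmx @` T) (lsubmx s) /\ minkowski_diff M (rsubmx @` T) (rsubmx s).
Proof.
split=> [/minkowski_diffP h|[/minkowski_diffP hL /minkowski_diffP hM]].
  split; apply/minkowski_diffP => _ [t Tt <-]; rewrite -linearD/=;
  by have /set_row_mxP[] := h t Tt.
apply/minkowski_diffP => t Tt; apply/set_row_mxP; rewrite !linearD/=.
by split; [apply: hL|apply: hM]; exists t.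
Qed.

(** A common translation vector [s] supplies the missing component when a vector of one factor is
    extended to the product. *)
Lemma sconv_hull_row_mx L M T y : minkowski_diff (set_row_mx L M) T !=set0 ->
  sconv_hull (set_row_mx L M) T y <->
  sconv_hull L (lsubmx @` T) (lsubmx y) /\ sconv_hull M (rsubmx @` T) (rsubmx y).
Proof.
move=> [s /minkowski_diff_row_mx[Ls Ms]]; split.
  move=> /minkowski_diffP h; split; apply/minkowski_diffP => t Tt.
    have /set_row_mxP[] : set_row_mx L M (y + row_mx t (rsubmx s)).
      by apply: h; apply/minkowski_diff_row_mx; rewrite row_mxKl row_mxKr.
    by rewrite linearD/= row_mxKl.
  have /set_row_mxP[] : set_row_mx L M (y + row_mx (lsubmx s) t).
    by apply: h; apply/minkowski_diff_row_mx; rewrite row_mxKl row_mxKr.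
  by rewrite !linearD/= row_mxKr.
move=> [/minkowski_diffP hL /minkowski_diffP hM].
apply/minkowski_diffP => t /minkowski_diff_row_mx[Lt Mt].
by apply/set_row_mxP; rewrite !linearD/=; split; [exact: hL|exact: hM].
Qed.

Lemma product_caratheodory L M : (0 < l)%N -> (0 < m)%N ->
  generating_set L -> generating_set M ->
  caratheodory_property (set_row_mx L M) (l + m).
Proof.
move=> l0 m0 gL gM X /finite_seqP[s ->{X}] [v Xv]; set K := set_row_mx L M.
apply/seteqP; split=> y; last by move=> [Y [YX _]]; exact: sconv_hullS.
(* The pointed form needs a point of [X]; for empty [X], [Y = X] will do. *)
have [s0|[x0 x0s]] : [set` s] = set0 \/ [set` s] !=set0.
  by have [->|/set0P] := eqVneq [set` s] set0; [left|right].
  move=> sy; exists [set` s] => //; split=> //; rewrite s0; exact: card_ge0.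
(* Common labels are needed because the projections to the factors may identify points of [X]. *)
pose f (i : seq_sub s) := ssval i.
have fE : [set` s] = f @` [set` [set: seq_sub s]%SET].
  apply/seteqP; split=> [x xs|_ [i _ <-]]; last exact: ssvalP.
  by exists (SeqSub xs) => //=; rewrite inE.
have KY (Y : {set seq_sub s}) : minkowski_diff K (f @` [set` Y]) (- v).
  apply/minkowski_diff_imageP => i _; have [k Kk kv] := Xv _ (ssvalP i).
  by rewrite /f /= -kv addrC addrK.
have hullE (Y : {set seq_sub s}) : sconv_hull K (f @` [set` Y]) y <->
    sconv_hull L ((lsubmx \o f) @` [set` Y]) (lsubmx y) /\
    sconv_hull M ((rsubmx \o f) @` [set` Y]) (rsubmx y).
  have := @sconv_hull_row_mx L M (f @` [set` Y]) y (ex_intro _ (- v) (KY Y)).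
  by rewrite !image_comp.
have pointed d (G : set 'rV[R]_d) (h : seq_sub s -> 'rV[R]_d) z w : generating_set G ->
    (forall i, G (w + h i)) ->
    pointed_caratheodory (fun Y => sconv_hull G (h @` [set` Y]) z) d.
  move=> gG Gw W p pW; apply: generating_caratheodory => //.
  by exists w; apply/minkowski_diff_imageP.
have mono d (G : set 'rV[R]_d) (h : seq_sub s -> 'rV[R]_d) z :
    monotone_family (fun Y => sconv_hull G (h @` [set` Y]) z).
  move=> A B /fintype.subsetP AB; apply: sconv_hullS => _ [i iA <-].
  by exists i => //; exact: AB.
have Kv i : L (lsubmx (- v) + lsubmx (f i)) /\ M (rsubmx (- v) + rsubmx (f i)).
  rewrite -!linearD/=; apply/set_row_mxP.
  by have /minkowski_diff_imageP/(_ i) := KY [set: _]%SET; apply; rewrite inE.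
rewrite fE => /hullE[yL yM].
have [Y [Ylm YL YM]] := joint_caratheodory (SeqSub x0s) l0 m0
  (mono _ L (lsubmx \o f) (lsubmx y)) (mono _ M (rsubmx \o f) (rsubmx y))
  (pointed _ L (lsubmx \o f) (lsubmx y) _ gL (fun i => (Kv i).1))
  (pointed _ M (rsubmx \o f) (rsubmx y) _ gM (fun i => (Kv i).2)) yL yM.
exists (f @` [set` Y]); last exact/hullE.
split; first by move=> _ [i _ <-]; exists i => //=; rewrite inE.
apply: (card_le_trans (card_image_le _ _)).
by apply: (card_le_trans (card_le_finset Y)); rewrite card_le_II.
Qed.

End product.

(** * Convex bodies in a product *)

Section product_body.
Context {R : realType} {l m : nat}.

Lemma normr_coord_le n (x : 'rV[R]_n) j : `|x 0 j| <= `|x|.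
Proof.
rewrite [leRHS]/Num.norm/= mx_normrE.
exact: (le_bigmax _ (fun ij => `|x ij.1 ij.2|) (0, j)).
Qed.

Lemma convex_body_row_mx (L : set 'rV[R]_l) (M : set 'rV[R]_m) :
  convex_body L -> convex_body M -> convex_body (set_row_mx L M).
Proof.
move=> [cL /convex_setP vL [x Lx]] [cM /convex_setP vM [y My]]; split.
- apply: bounded_closed_compact.
    have [BL [BLr hL]] := compact_bounded cL; have [BM [BMr hM]] := compact_bounded cM.
    exists (Num.max BL BM); split; first by rewrite max_real.
    move=> r; rewrite gt_max => /andP[rL rM] z /set_row_mxP[/(hL r rL) zL /(hM r rM) zM] /=.
    rewrite [leLHS]/Num.norm/= mx_normrE; apply/bigmax_leP; split.
      exact: le_trans zL.
    move=> [i j] _ /=; rewrite (ord1 i) -(hsubmxK z).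
    have [k ->|k ->] := split_ordP j; rewrite ?row_mxEl ?row_mxEr.
      exact: le_trans (normr_coord_le _ _) zL.
    exact: le_trans (normr_coord_le _ _) zM.
  have -> : set_row_mx L M = lsubmx @^-1` L `&` rsubmx @^-1` M.
    by apply/seteqP; split=> z /set_row_mxP.
  apply: closedI; apply: preimage_closed.
  + by move=> z _; exact: continuous_lsubmx.
  + by apply: compact_closed => //; exact: norm_hausdorff.
  + by move=> z _; exact: continuous_rsubmx.
  + by apply: compact_closed => //; exact: norm_hausdorff.
- apply/convex_setP => z t a b /set_row_mxP[Lz Mz] /set_row_mxP[Lt Mt] a0 b0 ab.
  by apply/set_row_mxP; rewrite !linearP/= !linearZ/=; split; [exact: vL|exact: vM].
- exists (row_mx x y); apply: (@filterS _ (nbhs (row_mx x y)) _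
      (lsubmx @^-1` L `&` rsubmx @^-1` M)).
    by move=> z [? ?]; apply/set_row_mxP.
  apply: filterI; first by apply: continuous_lsubmx; rewrite row_mxKl.
  by apply: continuous_rsubmx; rewrite row_mxKr.
Qed.

End product_body.

(** * Contact balls, their normals and the lower bound *)

Section lower_bound.
Context {R : realType} {n : nat}.
Implicit Types (K : set 'rV[R]_n) (u v w z : 'rV[R]_n).

Lemma dot_cauchy_schwarz u v : dot u v ^+ 2 <= dot u u * dot v v.
Proof.
have [->|v0] := eqVneq v 0; first by rewrite !dot0r expr0n/= mulr0.
have vv : 0 < dot v v by rewrite dot_gt0.
have := dot_ge0 (dot v v *: u - dot u v *: v).
rewrite dotBB !dotZl !dotZr => h.
have : 0 <= dot v v * (dot u u * dot v v - dot u v ^+ 2).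
  by apply: le_trans h _; rewrite le_eqVlt; apply/orP; left; apply/eqP; ring.
by rewrite pmulr_rge0// subr_ge0.
Qed.

Lemma small_scale (e a : R) : 0 < e -> 0 <= a -> exists2 t, 0 < t & t ^+ 2 * a <= e.
Proof.
move=> e0 a0; have ea : 0 < e + a by rewrite ltr_wpDr.
exists (e / (e + a)); first exact: divr_gt0.
rewrite expr_div_n mulrAC ler_pdivrMr ?exprn_gt0//; nra.
Qed.

Lemma interior_euclidean_ball K : interior K !=set0 ->
  exists c e, 0 < e /\ forall z, dot (z - c) (z - c) <= e -> K z.
Proof.
move=> [c /nbhs_ballP[r /= r0 rK]]; exists c, ((r / 2) ^+ 2).
split=> [|z zc]; first by rewrite exprn_gt0// divr_gt0.
apply: rK; rewrite mx_norm_ball /ball_/= distrC.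
have : `|z - c| <= r / 2.
  have r2 : 0 <= r / 2 by rewrite divr_ge0// ltW.
  rewrite -(@ler_pXn2r _ 2)// ?nnegrE//.
  exact: le_trans (sqr_norm_le_dot _) zc.
by lra.
Qed.

(* For [u != 0]: the ball about [c] of radius [1 / |u|] lies in [K] and touches the
   supporting hyperplane of [K] with normal [u]. *)
Definition contact K u c : Prop :=
  (forall k, K k -> dot u (k - c) <= 1) /\
  (forall z, dot (z - c) (z - c) * dot u u <= 1 -> K z).

(* [u] is a longest vector of the polar body of [K - c]. *)
Lemma contact_exists K c e : compact K -> convex_set K -> 0 < e ->
  (forall z, dot (z - c) (z - c) <= e -> K z) -> exists u, contact K u c.
Proof.
move=> cK vK e0 eK.
have Kt t u : t ^+ 2 * dot u u <= e -> K (c + t *: u).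
  by move=> h; apply: eK; rewrite addrC addKr dotZl dotZr mulrA -expr2.
pose polar := [set u | forall k, K k -> dot u (k - c) <= 1].
have polar0 : polar 0 by move=> k _; rewrite dot0l.
have polar_bounded u : polar u -> dot u u < 4 / e.
  move=> pu; rewrite ltNge; apply/negP => hu.
  have u0 : 0 < dot u u by apply: lt_le_trans hu; rewrite divr_gt0.
  (* If [u] were this long, the point would lie in the ball about [c], yet [u] takes the value 2
     there. *)
  have /pu : K (c + (2 / dot u u) *: u).
    apply: Kt; have -> : (2 / dot u u) ^+ 2 * dot u u = 4 / dot u u.
      by field; rewrite gt_eqF.
    by rewrite ler_pdivrMr//; move: hu; rewrite ler_pdivrMr//; lra.
  by rewrite addrC addKr dotZr divfK ?gt_eqF//; lra.
have cpolar : compact polar.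
  apply: bounded_closed_compact.
    exists (1 + 4 / e); split; first exact: num_real.
    move=> r hr u /polar_bounded hu /=; have := sqr_norm_le_dot u.
    have : 0 < 4 / e by rewrite divr_gt0.
    by rewrite (leNgt `|u|) => e4 hn; apply/negP => ru; nra.
  have -> : polar = \bigcap_(k in K) [set u | dot (k - c) u <= 1].
    by apply/seteqP; split=> u hu k Kk; have := hu k Kk; rewrite /= dotC.
  by apply: closed_bigI => k _; exact: closed_dot_le.
have [|u pu umax] := compact_max cpolar (ex_intro _ 0 polar0) (f := fun u => dot u u).
  by apply: dot_continuous => x.
exists u; split=> // z hz; apply: contrapT => nKz.
(* A point [z] outside [K] gives a normal [w] whose multiple by 1 / s is polar, so |w| <= s |u| by
   maximality; Cauchy-Schwarz then contradicts the position of [z] in the ball. *)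
have [|p Kp pmin] := nearest_point z cK vK.
  by exists c; apply: eK; rewrite subrr dot0r ltW.
have [w wE] : exists w, w = z - p by exists (z - p).
have w0 : 0 < dot w w.
  by rewrite dot_gt0 wE subr_eq0; apply/eqP => zp; apply: nKz; rewrite zp.
pose s := dot w (p - c).
have ws k : K k -> dot w (k - c) <= s.
  by move/pmin; rewrite -wE /s !dotDr !dotNr; lra.
have s0 : 0 < s.
  have [t t0 te] := small_scale e0 (dot_ge0 w).
  by have := ws _ (Kt _ _ te); rewrite addrC addKr dotZr; apply: lt_le_trans; rewrite mulr_gt0.
have /umax : polar (s^-1 *: w).
  by move=> k /ws; rewrite dotZl mulrC ler_pdivrMr// mul1r.
rewrite dotZl dotZr mulrA -expr2 exprVn mulrC ler_pdivrMr ?exprn_gt0// => hw.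
have zs : s < dot w (z - c).
  have -> : z - c = w + (p - c) by rewrite wE addrA subrK.
  by rewrite dotDr -/s ltrDr.
have := dot_cauchy_schwarz w (z - c).
have : s ^+ 2 < dot w (z - c) ^+ 2 by rewrite ltr_pXn2r// nnegrE ltW// (lt_trans s0).
have := dot_ge0 (z - c); nra.
Qed.

(** Among balls of a fixed radius in [K], take one furthest in direction [w] and move its centre
    slightly further, to [c']. The ball of the same radius no longer fits, and this forces the
    contact normal at [c'] to have positive product with [w]. *)
Lemma contact_direction K w : compact K -> convex_set K -> interior K !=set0 ->
  w != 0 -> exists u c, contact K u c /\ dot u w != 0.
Proof.
move=> cK vK /interior_euclidean_ball[c0 [e [e0 eK]]] w0.
pose T := [set t : 'rV[R]_n | dot t t <= e].
have KTE c : minkowski_diff K T c <-> forall z, dot (z - c) (z - c) <= e -> K z.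
  split=> [/minkowski_diffP h z zc|h].
    by rewrite -(subrK c z) addrC; exact: h.
  by apply/minkowski_diffP => t Tt; apply: h; rewrite addrC addKr.
have [|c /KTE cT cmax] := compact_max (minkowski_diff_compact (T := T) cK _)
    (ex_intro _ c0 ((KTE c0).2 eK)) (dotl_continuous (u := w)).
  by exists 0; rewrite /T /= dot0r ltW.
have [d d0 de] := small_scale (divr_gt0 e0 (ltr0Sn R 3)) (dot_ge0 w).
pose c' := c + d *: w.
(* Half the radius fits around [c'], since the shift is at most the other half. *)
have [||u [uK Ku]] := @contact_exists K c' (e / 4) cK vK.
- exact: divr_gt0.
- move=> z zc'; apply: cT.
  have -> : z - c = (z - c') + d *: w by rewrite /c' opprD addrA subrK.
  have dw : dot (d *: w) (d *: w) <= e / 4 by rewrite dotZl dotZr mulrA -expr2.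
  by apply: (le_trans (dotDD_le _ _)); lra.
exists u, c'; split=> //.
have [t te nKt] : exists2 t, dot t t <= e & ~ K (c' + t).
  apply: contrapT => h; have /cmax : minkowski_diff K T c'.
    apply/minkowski_diffP => t Tt; apply: contrapT => nK; apply: h; by exists t.
  by rewrite dotDr dotZr gerDl leNgt mulr_gt0// dot_gt0.
have tu : 1 < dot t t * dot u u.
  by rewrite ltNge; apply/negP => h; apply: nKt; apply: Ku; rewrite addrC addKr.
have u0 : 0 < dot u u by have := dot_ge0 u; have := dot_ge0 t; nra.
pose a := e * dot u u; have a1 : 1 < a by apply: lt_le_trans tu _; rewrite ler_pM2r.
(* The number 2a / (1 + a) lies strictly between 1 and the square root of [a]: the point is in the
   ball about [c], and the contact inequality at [c'] then forces [dot u w > 0]. *)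
have : K (c + (2 * a / (1 + a) / dot u u) *: u).
  apply: cT; rewrite addrC addKr dotZl dotZr mulrA -expr2.
  have -> : (2 * a / (1 + a) / dot u u) ^+ 2 * dot u u = e * (4 * a / (1 + a) ^+ 2).
    have un : dot u u != 0 by rewrite gt_eqF.
    have an : 1 + e * dot u u != 0 by rewrite -/a gt_eqF//; lra.
    by rewrite /a; field; rewrite un an.
  rewrite ger_pMr// ler_pdivrMr ?exprn_gt0//; [nra|lra].
move/uK; have -> : c + (2 * a / (1 + a) / dot u u) *: u - c' =
    (2 * a / (1 + a) / dot u u) *: u - d *: w.
  by rewrite /c'; apply/rowP => i; rewrite !mxE; ring.
rewrite dotDr dotNr !dotZr divfK; last by rewrite gt_eqF.
move=> h; have h1 : 1 < 2 * a / (1 + a) by rewrite ltr_pdivlMr; lra.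
have : 0 < d * dot u w by lra.
by rewrite pmulr_rgt0// => /gt_eqF ->.
Qed.

(** Normals are found one at a time: each new one has non-zero product with a vector [w] orthogonal
    to all previous ones. *)
Lemma contact_basis K : compact K -> convex_set K -> interior K !=set0 ->
  exists U : 'M[R]_n, U \in unitmx /\ forall i, exists c, contact K (row i U) c.
Proof.
move=> cK vK iK.
have : forall k, (k <= n)%N -> exists U : 'M[R]_(k, n),
    row_free U /\ forall i, exists c, contact K (row i U) c.
  elim=> [_|k IH kn].
    by exists 0; split; [rewrite -row_leq_rank mxrank0|case].
  have [U [fU Uc]] := IH (ltnW kn).
  have [w w0 Uw] : exists2 w : 'rV[R]_n, w != 0 & U *m w^T = 0.
    have : (kermx U^T : 'M[R]_n) != 0.
      rewrite -mxrank_eq0 mxrank_ker mxrank_tr (eqP fU) -lt0n; lia.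
    case/rowV0Pn => w /sub_kermxP wU w0; exists w => //.
    by rewrite -[LHS]trmxK trmx_mul trmxK wU trmx0.
  have [v [c [vc vw]]] := contact_direction cK vK iK w0.
  rewrite -add1n; exists (col_mx v U); split.
    apply: inj_row_free => x; rewrite -[x]hsubmxK.
    move: (lsubmx x) (rsubmx x) => a b; rewrite mul_row_col => abvU.
    have a0 : a = 0.
      have : (a *m v + b *m U) *m w^T = 0 by rewrite abvU mul0mx.
      rewrite mulmxDl -!mulmxA Uw mulmx0 addr0 (mx11_scalar (v *m w^T)) mul_mx_scalar.
      by move/eqP; rewrite scalemx_eq0 -[_ 0 0]/(dot v w) (negbTE vw) => /eqP.
    move: abvU; rewrite a0 mul0mx add0r => /eqP; rewrite mulmx_free_eq0// => /eqP ->.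
    by rewrite row_mx0.
  move=> i; have [j ->|j ->] := split_ordP i.
    by exists c; rewrite rowKu (ord1 j) row_id.
  by rewrite rowKd; exact: Uc.
by move=> /(_ n (leqnn n))[U [fU Uc]]; exists U; rewrite -row_free_unit.
Qed.

Lemma caratheodory_lower_bound K c : (0 < n)%N -> convex_body K ->
  caratheodory_property K c -> (n <= c)%N.
Proof.
move=> n0 [cK vK iK] Kc; rewrite leqNgt; apply/negP => cn.
have [U [uU /choice[ctr Uctr]]] := contact_basis cK vK iK.
pose u i := row i U.
have un i : dot (u i) (u i) != 0.
  rewrite dot_eq0 /u rowE mulmx_free_eq0 ?row_free_unit//.
  by apply/eqP => /rowP/(_ i)/eqP; rewrite !mxE !eqxx oner_eq0.
(* Row [j] of [X] solves the linear system <u_i, x_j> = n [i = j] - 1. *)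
pose X := (invmx U *m (n%:R%:M - const_mx 1))^T.
pose x j := row j X.
have ux i j : dot (u i) (x j) = n%:R * (i == j)%:R - 1.
  have -> : dot (u i) (x j) = (U *m X^T) i j.
    by rewrite dotE mxE; apply: eq_bigr => k _; rewrite !mxE.
  by rewrite trmxK mulKVmx// !mxE mulr_natr.
have sumx : \sum_j x j = 0.
  suff : U *m (\sum_j x j)^T = 0.
    by move/(congr1 (mulmx (invmx U))); rewrite mulKmx// mulmx0 => /eqP; rewrite trmx_eq0 => /eqP.
  apply/matrixP => i k; rewrite (ord1 k).
  have -> : (U *m (\sum_j x j)^T) i 0 = dot (u i) (\sum_j x j).
    by rewrite dotE mxE; apply: eq_bigr => ? _; rewrite !mxE.
  rewrite dot_sumr (eq_bigr _ (fun j _ => ux i j)) sumrB -mulr_sumr.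
  rewrite (bigD1 i)//= eqxx big1 => [|j ji]; last by rewrite eq_sym (negbTE ji).
  by rewrite sumr_const card_ord mxE addr0 mulr1 subrr.
(* A crude common bound for all |x_i|^2 |u_j|^2; the scale e = 1 / (1 + s) then makes e |x_i|^2
   |u_j|^2 <= 1. *)
pose s := \sum_i \sum_j dot (x i) (x i) * dot (u j) (u j).
have s0 : 0 <= s.
  by do 2!(apply: sumr_ge0 => ? _); rewrite mulr_ge0// dot_ge0.
have xu_s i j : dot (x i) (x i) * dot (u j) (u j) <= s.
  rewrite /s (bigD1 i)//= (bigD1 j)//= -addrA lerDl addr_ge0//.
    by apply: sumr_ge0 => ? _; rewrite mulr_ge0// dot_ge0.
  by do 2!(apply: sumr_ge0 => ? _); rewrite mulr_ge0// dot_ge0.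
pose e := (1 + s)^-1.
have e0 : 0 < e by rewrite invr_gt0 ltr_wpDr.
have e1 : e <= 1 by rewrite invf_le1 ?ltr_wpDr// lerDl.
have ex i j : e * (dot (x i) (x i) * dot (u j) (u j)) <= 1.
  rewrite mulrC ler_pdivrMr ?ltr_wpDr// mul1r; have := xu_s i j; lra.
pose f j := e *: x j.
have f_inj : injective f.
  move=> i j /(scalerI (lt0r_neq0 e0)) xij; have := ux i j; rewrite -xij ux eqxx mulr1.
  have [//|_] := eqVneq i j; rewrite mulr0 => /addIr/eqP.
  by rewrite pnatr_eq0 => /eqP n_eq0; rewrite n_eq0 in n0.
pose Xs := f @` [set: 'I_n].
pose j0 := Ordinal n0.
have : sconv_hull K Xs 0.
  apply/minkowski_diffP => t /minkowski_diffP Kt; rewrite add0r.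
  have [|||p Kp] := convex_sum (w := fun _ : 'I_n => 1) (f := fun j => t + f j) vK.
  - by move=> _; exact: ler01.
  - by move=> j _; apply: Kt; exists j.
  - by rewrite sumr_const card_ord ltr0n.
  rewrite (eq_bigr (fun j => t + f j)); last by move=> j _; rewrite scale1r.
  rewrite big_split/= -scaler_sumr sumx scaler0 addr0 !sumr_const card_ord scaler_nat.
  by move/eqP; rewrite -subr_eq0 -mulrnBl -scaler_nat scaler_eq0 pnatr_eq0
    gtn_eqF//= subr_eq0 => /eqP ->.
rewrite Kc; last 2 first.
- exact: finite_image.
- exists (- ctr j0) => _ [j _ <-]; exists (f j + ctr j0); last by rewrite addrK.
  have [_] := Uctr j0; apply; rewrite addrK /f dotZl dotZr.
  have := ex j j0; have := mulr_ge0 (dot_ge0 (x j)) (dot_ge0 (u j0)).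
  rewrite -/(u j0); nra.
move=> [Y [YX Yc] Y0].
have [j jY] : exists j, ~ Y (f j).
  apply: contrapT => hY.
  have fY j : Y (f j) by apply: contrapT => nY; apply: hY; exists j.
  pose g (y : 'rV[R]_n) : nat := odflt j0 [pick j | f j == y].
  have : (`I_n #<= `I_c)%card.
    apply: card_le_trans Yc; apply: card_le_trans (card_image_le g Y).
    apply: subset_card_le => i /= ni; exists (f (Ordinal ni)) => //.
    by rewrite /g; case: pickP => [k /eqP/f_inj ->//|/(_ (Ordinal ni))]; rewrite eqxx.
  by rewrite card_le_II leqNgt cn.
have [uK Ku] := Uctr j; rewrite -/(u j) in uK Ku.
(* [t] lies just beyond the touching point, hence outside [K]: [u j] takes the value 1 + e / 2 at
   [t - ctr j]. As <u_j, x_i> = -1, adding [f i] lowers this by [e], which together with the bound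
   on [e] brings the point back into the contact ball. *)
pose t := ctr j + ((1 + e / 2) / dot (u j) (u j)) *: u j.
have : K t.
  rewrite -[t]add0r; move/minkowski_diffP : Y0; apply.
  apply/minkowski_diffP => y Yy; have [i _ fi] := YX y Yy.
  have ij : (j == i) = false.
    by apply/eqP => ji; apply: jY; rewrite ji fi.
  apply: Ku; rewrite -fi.
  have -> : t + f i - ctr j = ((1 + e / 2) / dot (u j) (u j)) *: u j + e *: x i.
    by rewrite /t /f; apply/rowP => k; rewrite !mxE; ring.
  rewrite dotDD !dotZl !dotZr ux ij mulr0 sub0r.
  have := ex i j; have := un j; move: (dot (u j) (u j)) (dot (x i) (x i)) => N M N0 eMN.
  rewrite [leLHS](_ : _ = (1 + e / 2) ^+ 2 - 2 * e * (1 + e / 2) + e * (e * (M * N)));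
    last by field.
  by nra.
move/uK; rewrite /t addrC addKr dotZr divfK//; lra.
Qed.

End lower_bound.

Theorem theorem1p6 (R : realType) (l m : nat) (hl : (1 <= l)%N) (hm : (1 <= m)%N)
    (L : set 'rV[R]_l) (M : set 'rV[R]_m)
    (hL : generating_set L) (hM : generating_set M) :
  is_caratheodory_number (set_row_mx L M) (l + m)%N.
Proof.
split; first exact: product_caratheodory.
move=> c; apply: caratheodory_lower_bound; first by rewrite addn_gt0 hl.
by apply: convex_body_row_mx; [case: hL|case: hM].
Qed.
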